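(* Let $0<\lambda<1/e$, $E(z)=\lambda e^z$, $x_0>\beta$ and $\varepsilon>0$. Then $\mathcal X(x_0,L^\varepsilon)\subset\mathcal J(E)\setminus\mathcal C$, where $\mathcal X(x_0,L^\varepsilon)=\{w\in\mathbb C:\operatorname{Re}E^j(w)>E^j(x_0)\text{ and }x_0<\operatorname{Re}E^j(w),\ |\operatorname{Im}E^j(w)|<L^\varepsilon(\operatorname{Re}E^j(w))\text{ for all }j\in\mathbb N\}$.
   Context: For $0<\lambda<1/e$, $E(z)=\lambda e^z$ has real fixed points $\alpha<1<\beta$ ($\alpha$ attracting, $\beta$ repelling, $E'(\beta)=\beta$). $\mathcal J(E)$ is the Julia set; by Devaney–Krych it is a union of pairwise disjoint curves (''hairs'') each joining a finite endpoint to $\infty$, each hair being the set of points of $\mathcal J(E)$ with a given itinerary (the sequence $(s_j)$ with $(2s_j-1)\pi\le\operatorname{Im}E^j(z)<(2s_j+1)\pi$); $\mathcal C$ is the set of endpoints of the hairs. Fractional iterates: $S$ is the entire solution of $S(\beta z)=E(S(z))$ with $S(0)=\beta$, $S'(0)=1$, an increasing bijection $\mathbb R\to(\alpha,\infty)$; for $r\in\mathbb R$, $E^r(\alpha)=\alpha$, $E^r(x)=S(\beta^rS^{-1}(x))$ for $x>\alpha$, and $L^r=E^{-r}$ (so $L(x)=\log x-\log\lambda$). *)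

(* Defs.v *)
From Stdlib Require Import Reals Lra ZArith.
Open Scope R_scope.

Definition Cx := (R * R)%type.
Definition Re (z : Cx) : R := fst z.
Definition Im (z : Cx) : R := snd z.
Definition Cnorm (z : Cx) : R := sqrt (Re z ^ 2 + Im z ^ 2).
Definition Cdist (z w : Cx) : R := Cnorm (Re z - Re w, Im z - Im w).

Definition Eexp (lam : R) (z : Cx) : Cx :=
  (lam * exp (Re z) * cos (Im z), lam * exp (Re z) * sin (Im z)).
Definition Eiter (lam : R) (j : nat) (z : Cx) : Cx := Nat.iter j (Eexp lam) z.
Definition Eriter (lam : R) (j : nat) (x : R) : R := Nat.iter j (fun t => lam * exp t) x.

(* Riemann sphere: None = infinity; chordal metric *)
Definition chordal (a b : option Cx) : R :=
  match a, b with
  | Some a, Some b => 2 * Cdist a b / sqrt ((1 + Cnorm a ^ 2) * (1 + Cnorm b ^ 2))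
  | Some a, None | None, Some a => 2 / sqrt (1 + Cnorm a ^ 2)
  | None, None => 0
  end.

(* {E^n} is a normal family on the open disc D(z0, r): every sequence of iterates
   has a subsequence converging locally uniformly (chordal metric, limit may be oo);
   local uniformity on a disc = uniformity on each smaller closed concentric disc. *)
Definition normal_on_disc (lam : R) (z0 : Cx) (r : R) : Prop :=
  forall m : nat -> nat,
    exists (phi : nat -> nat) (g : Cx -> option Cx),
      (forall k, (phi k < phi (S k))%nat) /\
      forall rho, 0 < rho < r -> forall e, 0 < e ->
        exists K, forall k, (K <= k)%nat -> forall z, Cdist z z0 <= rho ->
          chordal (Some (Eiter lam (m (phi k)) z)) (g z) < e.

Definition Fatou (lam : R) (z : Cx) : Prop := exists r, 0 < r /\ normal_on_disc lam z r.
Definition Julia (lam : R) (z : Cx) : Prop := ~ Fatou lam z.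

Definition has_itinerary (lam : R) (z : Cx) (s : nat -> Z) : Prop :=
  forall j : nat,
    (2 * IZR (s j) - 1) * PI <= Im (Eiter lam j z) < (2 * IZR (s j) + 1) * PI.

Definition hair (lam : R) (s : nat -> Z) (z : Cx) : Prop :=
  Julia lam z /\ has_itinerary lam z s.

Definition is_endpoint_of (H : Cx -> Prop) (z : Cx) : Prop :=
  exists gamma : R -> Cx,
    gamma 0 = z /\
    (forall t, 0 <= t -> forall e, 0 < e -> exists d, 0 < d /\
        forall u, 0 <= u -> Rabs (u - t) < d -> Cdist (gamma u) (gamma t) < e) /\
    (forall t u, 0 <= t -> 0 <= u -> gamma t = gamma u -> t = u) /\
    (forall w, H w <-> exists t, 0 <= t /\ gamma t = w) /\
    (forall M, exists T, forall t, T <= t -> M < Cnorm (gamma t)).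

Definition Endpoints (lam : R) (z : Cx) : Prop :=
  exists s : nat -> Z, is_endpoint_of (hair lam s) z.

(* L^r(x) = E^{-r}(x) = S(beta^{-r} S^{-1}(x)) for x > alpha; "v < L^r(x)" *)
Definition lt_Lfrac (S : R -> R) (beta r x v : R) : Prop :=
  exists y, S y = x /\ v < S (Rpower beta (- r) * y).

Definition Xset (lam : R) (S : R -> R) (beta x0 eps : R) (w : Cx) : Prop :=
  forall j : nat,
    Re (Eiter lam j w) > Eriter lam j x0 /\
    x0 < Re (Eiter lam j w) /\
    lt_Lfrac S beta eps (Re (Eiter lam j w)) (Rabs (Im (Eiter lam j w))).

(* Main.v *)
(** The map [E] expands by at least [beta > 1] where [Re >= beta], and it is injective on each strip
of the itinerary; so two points whose orbits stay in common strips, and are at bounded distance at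
time [n] with real parts [>= beta], start within [O(beta^(-n))] of each other.

A point [w] with [Re (E^j w) >= beta] escaping to infinity is in the Julia set: pulling back nearby
points that land on the negative real axis produces bounded orbits arbitrarily close to [w].

If [w] is in the set [X] and [u] is such that [S u = Re (E^N w)], then
[S u - S (beta^(-eps) u) >= (1 - beta^(-eps)) u] is large for large [N], while
[|Im (E^(N+k) w)|] is at most [E^k (S (beta^(-eps) u))]. This leaves room for a point [z] with the
itinerary of [w] and [Re (E^(N+k) z)] about [E^k y], where [S (beta^(-eps) u) < y < S u]; it lies on
the hair of [w] and escapes more slowly than [w]. If [w] were the endpoint of that hair, the part of
the hair from [z] to infinity would cross [Re (E^n) = Re (E^n w)] for every large [n], at points
converging to [w] by expansion, although it stays away from [w]. *)

From Coquelicot Require Import Rcomplements Hierarchy Derive AutoDerive.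
From Stdlib Require Import Reals Lra Lia ZArith ClassicalEpsilon.
Require Import Defs.
Open Scope R_scope.

(** * The exponential map and its inverse branches *)

Lemma Cnorm_sq z : Cnorm z ^ 2 = Re z ^ 2 + Im z ^ 2.
Proof. unfold Cnorm; rewrite pow2_sqrt; nra. Qed.

Lemma Cnorm_pos z : 0 <= Cnorm z.
Proof. apply sqrt_pos. Qed.

Lemma Cnorm_le z M : 0 <= M -> Re z ^ 2 + Im z ^ 2 <= M ^ 2 -> Cnorm z <= M.
Proof.
intros HM H. pose proof (Cnorm_pos z). rewrite <- Cnorm_sq in H. nra.
Qed.

Lemma le_Cnorm z M : M ^ 2 <= Re z ^ 2 + Im z ^ 2 -> M <= Cnorm z.
Proof.
intros H. pose proof (Cnorm_pos z). rewrite <- Cnorm_sq in H. nra.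
Qed.

Lemma Re_le_Cnorm z : Rabs (Re z) <= Cnorm z.
Proof. apply le_Cnorm. rewrite pow2_abs. nra. Qed.

Lemma Im_le_Cnorm z : Rabs (Im z) <= Cnorm z.
Proof. apply le_Cnorm. rewrite pow2_abs. nra. Qed.

Lemma Cnorm_le_sum z : Cnorm z <= Rabs (Re z) + Rabs (Im z).
Proof.
pose proof (Rabs_pos (Re z)). pose proof (Rabs_pos (Im z)).
apply Cnorm_le; [lra |].
rewrite <- (pow2_abs (Re z)), <- (pow2_abs (Im z)). nra.
Qed.

Lemma Cdist_pos z w : 0 <= Cdist z w.
Proof. apply Cnorm_pos. Qed.

Lemma Cdist_refl z : Cdist z z = 0.
Proof.
apply Rle_antisym; [| apply Cdist_pos].
apply Cnorm_le; [lra |]. simpl. lra.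
Qed.

Lemma Re_le_Cdist z w : Rabs (Re z - Re w) <= Cdist z w.
Proof. apply (Re_le_Cnorm (Re z - Re w, Im z - Im w)). Qed.

Lemma Im_le_Cdist z w : Rabs (Im z - Im w) <= Cdist z w.
Proof. apply (Im_le_Cnorm (Re z - Re w, Im z - Im w)). Qed.

Lemma Cdist_le_sum z w : Cdist z w <= Rabs (Re z - Re w) + Rabs (Im z - Im w).
Proof. apply (Cnorm_le_sum (Re z - Re w, Im z - Im w)). Qed.

(* The scalar mean value theorem applied to the component of the increment in its own direction. *)
Lemma plane_mean_value (f g f' g' : R -> R) (M : R) :
  (forall t, 0 <= t <= 1 -> derivable_pt_lim f t (f' t)) ->
  (forall t, 0 <= t <= 1 -> derivable_pt_lim g t (g' t)) ->
  0 <= M ->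
  (forall t, 0 <= t <= 1 -> f' t ^ 2 + g' t ^ 2 <= M ^ 2) ->
  Cdist (f 1, g 1) (f 0, g 0) <= M.
Proof.
intros Hf Hg HM Hb.
set (c := f 1 - f 0). set (d := g 1 - g 0).
destruct (MVT_cor2 (fun t => c * f t + d * g t) (fun t => c * f' t + d * g' t) 0 1)
  as (x & Hx & Hx01); [lra | |].
{ intros t Ht. apply derivable_pt_lim_plus; apply derivable_pt_lim_scal; auto. }
assert (Hcd : c ^ 2 + d ^ 2 = c * f' x + d * g' x).
{ transitivity ((c * f 1 + d * g 1) - (c * f 0 + d * g 0)); [unfold c, d; ring | lra]. }
specialize (Hb x ltac:(lra)).
apply Cnorm_le; [exact HM |]. simpl Re; simpl Im; fold c d.
assert ((c * f' x + d * g' x) ^ 2 <= (c ^ 2 + d ^ 2) * (f' x ^ 2 + g' x ^ 2))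
  by (pose proof (pow2_ge_0 (c * g' x - d * f' x)); nra).
assert (0 <= c ^ 2 + d ^ 2) by nra.
destruct (Req_dec (c ^ 2 + d ^ 2) 0); [nra |].
apply Rmult_le_reg_l with (c ^ 2 + d ^ 2); [lra |].
rewrite <- Hcd in H. nra.
Qed.

(** On the convex half-plane [Re <= c] the modulus lam e^Re of the derivative of E is at most
    [lam * exp c]; the increment is followed along the segment from [q] to [p]. *)
Lemma Eexp_lip lam c p q : 0 < lam -> Re p <= c -> Re q <= c ->
  Cdist (Eexp lam p) (Eexp lam q) <= lam * exp c * Cdist p q.
Proof.
intros Hlam Hp Hq.
set (dx := Re p - Re q). set (dy := Im p - Im q).
set (X := fun t => Re q + t * dx). set (Y := fun t => Im q + t * dy).
replace (Eexp lam p) with (lam * exp (X 1) * cos (Y 1), lam * exp (X 1) * sin (Y 1))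
  by (unfold Eexp, X, Y, dx, dy; do 2 f_equal; f_equal; f_equal; ring).
replace (Eexp lam q) with (lam * exp (X 0) * cos (Y 0), lam * exp (X 0) * sin (Y 0))
  by (unfold Eexp, X, Y, dx, dy; do 2 f_equal; f_equal; f_equal; ring).
pose proof (Cdist_pos p q).
pose proof (exp_pos c).
apply (plane_mean_value (fun t => lam * exp (X t) * cos (Y t))
         (fun t => lam * exp (X t) * sin (Y t))
         (fun t => lam * exp (X t) * (dx * cos (Y t) - dy * sin (Y t)))
         (fun t => lam * exp (X t) * (dx * sin (Y t) + dy * cos (Y t)))).
- intros t _. unfold X, Y. auto_derive; [easy |]. ring.
- intros t _. unfold X, Y. auto_derive; [easy |]. ring.
- apply Rmult_le_pos; nra.
- intros t Ht.
  assert (HX : X t <= c) by (unfold X, dx; nra).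
  assert (HE : exp (X t) <= exp c)
    by (destruct HX as [HX | ->]; [left; now apply exp_increasing | lra]).
  pose proof (exp_pos (X t)).
  pose proof (sin2_cos2 (Y t)) as Hsc. unfold Rsqr in Hsc.
  assert (HD : Cdist p q ^ 2 = dx ^ 2 + dy ^ 2) by (unfold Cdist; now rewrite Cnorm_sq).
  replace ((lam * exp (X t) * (dx * cos (Y t) - dy * sin (Y t))) ^ 2 +
           (lam * exp (X t) * (dx * sin (Y t) + dy * cos (Y t))) ^ 2)
    with ((lam * exp (X t)) ^ 2 * (dx ^ 2 + dy ^ 2)
          * (sin (Y t) * sin (Y t) + cos (Y t) * cos (Y t))) by ring.
  rewrite Hsc, Rmult_1_r, <- HD, (Rpow_mult_distr (lam * exp c)).
  apply Rmult_le_compat_r; [nra |].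
  apply pow_incr. nra.
Qed.

(* A branch of the inverse of [E] on [Re p > 0] only, because of [atan]. *)
Definition Llog (lam : R) (s : Z) (p : Cx) : Cx :=
  (ln (Re p ^ 2 + Im p ^ 2) / 2 - ln lam, atan (Im p / Re p) + 2 * PI * IZR s).

(** The derivative of a logarithm at a point has the inverse of its modulus as modulus, hence at
    most [/ b] on the convex half-plane [Re >= b]. *)
Lemma Llog_lip lam s b p q : 0 < b -> b <= Re p -> b <= Re q ->
  Cdist (Llog lam s p) (Llog lam s q) <= / b * Cdist p q.
Proof.
intros Hb Hp Hq.
set (dx := Re p - Re q). set (dy := Im p - Im q).
set (X := fun t => Re q + t * dx). set (Y := fun t => Im q + t * dy).
assert (Hpt : forall t p', X t = Re p' -> Y t = Im p' -> Llog lam s p' =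
  (ln (X t ^ 2 + Y t ^ 2) / 2 - ln lam, atan (Y t / X t) + 2 * PI * IZR s))
  by (intros t p' -> ->; reflexivity).
rewrite (Hpt 1 p), (Hpt 0 q) by (unfold X, Y, dx, dy; ring).
assert (HX : forall t, 0 <= t <= 1 -> b <= X t) by (intros t Ht; unfold X, dx; nra).
pose proof (Cdist_pos p q).
assert (HN : forall t, 0 <= t <= 1 -> 0 < X t * X t + Y t * Y t).
{ intros t Ht. specialize (HX t Ht).
  apply Rplus_lt_le_0_compat; [apply Rmult_lt_0_compat; lra | apply Rle_0_sqr]. }
assert (Hib : 0 < / b) by now apply Rinv_0_lt_compat.
apply (plane_mean_value (fun t => ln (X t ^ 2 + Y t ^ 2) / 2 - ln lam)
         (fun t => atan (Y t / X t) + 2 * PI * IZR s)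
         (fun t => (X t * dx + Y t * dy) / (X t ^ 2 + Y t ^ 2))
         (fun t => (X t * dy - Y t * dx) / (X t ^ 2 + Y t ^ 2))).
- intros t Ht. specialize (HN t Ht). unfold X, Y in *.
  auto_derive; [lra |]. field. lra.
- intros t Ht. specialize (HX t Ht). specialize (HN t Ht). unfold X, Y in *.
  auto_derive; [lra |]. field. split; lra.
- apply Rmult_le_pos; lra.
- intros t Ht. specialize (HX t Ht). specialize (HN t Ht).
  assert (HD : Cdist p q ^ 2 = dx ^ 2 + dy ^ 2) by (unfold Cdist; now rewrite Cnorm_sq).
  replace (((X t * dx + Y t * dy) / (X t ^ 2 + Y t ^ 2)) ^ 2 +
           ((X t * dy - Y t * dx) / (X t ^ 2 + Y t ^ 2)) ^ 2)
    with (/ (X t ^ 2 + Y t ^ 2) * (dx ^ 2 + dy ^ 2)) by (field; lra).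
  rewrite <- HD, (Rpow_mult_distr (/ b)).
  apply Rmult_le_compat_r; [nra |].
  rewrite pow_inv. apply Rinv_le_contravar; nra.
Qed.

Lemma sin_cos_period_Z x k : cos (x + 2 * PI * IZR k) = cos x /\ sin (x + 2 * PI * IZR k) = sin x.
Proof.
assert (Hn : forall y n, cos (y + 2 * PI * IZR (Z.of_nat n)) = cos y /\
                         sin (y + 2 * PI * IZR (Z.of_nat n)) = sin y).
{ intros y n. rewrite <- INR_IZR_INZ.
  replace (y + 2 * PI * INR n) with (y + 2 * INR n * PI) by ring.
  split; [apply cos_period | apply sin_period]. }
destruct (Z_le_gt_dec 0 k) as [Hk | Hk].
- rewrite <- (Z2Nat.id k) by exact Hk. apply Hn.
- destruct (Hn (x + 2 * PI * IZR k) (Z.to_nat (- k))) as [Hc Hs].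
  rewrite Z2Nat.id in Hc, Hs by lia. rewrite opp_IZR in Hc, Hs.
  replace (x + 2 * PI * IZR k + 2 * PI * - IZR k) with x in Hc, Hs by ring.
  now split.
Qed.

Lemma Eexp_Llog lam s p : 0 < lam -> 0 < Re p -> Eexp lam (Llog lam s p) = p.
Proof.
intros Hlam Hp. destruct p as [x y]. unfold Eexp, Llog. cbn [Re Im fst snd] in *.
destruct (sin_cos_period_Z (atan (y / x)) s) as [-> ->].
set (r := sqrt (x ^ 2 + y ^ 2)).
assert (Hr : 0 < r) by (apply sqrt_lt_R0; nra).
assert (Hr2 : r ^ 2 = x ^ 2 + y ^ 2) by (apply pow2_sqrt; nra).
assert (Hexp : lam * exp (ln (x ^ 2 + y ^ 2) / 2 - ln lam) = r).
{ rewrite <- Hr2. simpl pow. rewrite Rmult_1_r, ln_mult by exact Hr.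
  replace ((ln r + ln r) / 2 - ln lam) with (ln r + - ln lam) by field.
  rewrite exp_plus, exp_Ropp, !exp_ln by assumption. field. lra. }
rewrite Hexp, cos_atan, sin_atan.
replace (1 + (y / x)²) with ((r / x) ^ 2)
  by (unfold Rsqr; transitivity ((r ^ 2) / x ^ 2); [field; lra | rewrite Hr2; field; lra]).
rewrite sqrt_pow2 by (apply Rlt_le, Rdiv_lt_0_compat; lra).
f_equal; field; lra.
Qed.

Lemma cos_pos_range t : - PI <= t <= PI -> 0 < cos t -> - (PI / 2) < t < PI / 2.
Proof.
intros Ht Hc. pose proof PI_RGT_0.
split; apply Rnot_le_lt; intros H1.
- assert (cos (- t) <= 0) by (apply cos_le_0; lra). rewrite cos_neg in *. lra.
- assert (cos t <= 0) by (apply cos_le_0; lra). lra.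
Qed.

(** A positive real part of the image puts [Im p] within pi/2 of the centre 2 pi s of the strip,
    where [atan] inverts [tan]. *)
Lemma Llog_Eexp lam s p : 0 < lam ->
  (2 * IZR s - 1) * PI <= Im p < (2 * IZR s + 1) * PI ->
  0 < Re (Eexp lam p) -> Llog lam s (Eexp lam p) = p.
Proof.
intros Hlam Hs Hre. destruct p as [x y]. unfold Eexp, Llog in *. cbn [Re Im fst snd] in *.
set (t := y - 2 * PI * IZR s) in *.
assert (Hy : y = t + 2 * PI * IZR s) by (unfold t; ring).
destruct (sin_cos_period_Z t s) as [Hc Hsn]. rewrite <- Hy in Hc, Hsn.
pose proof (exp_pos x).
assert (Hcos : 0 < cos t).
{ rewrite <- Hc. apply Rmult_lt_reg_l with (lam * exp x); nra. }
f_equal.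
- pose proof (sin2_cos2 y) as H1. unfold Rsqr in H1.
  replace ((lam * exp x * cos y) ^ 2 + (lam * exp x * sin y) ^ 2)
    with ((lam * exp x) * (lam * exp x) * (sin y * sin y + cos y * cos y)) by ring.
  rewrite H1, Rmult_1_r, ln_mult, ln_mult, ln_exp by nra. field.
- rewrite Hc, Hsn.
  replace (lam * exp x * sin t / (lam * exp x * cos t)) with (tan t)
    by (unfold tan; field; nra).
  rewrite atan_tan; [unfold t; ring |].
  apply cos_pos_range; [unfold t; lra | exact Hcos].
Qed.

Lemma exp_le x y : x <= y -> exp x <= exp y.
Proof. intros [H | ->]; [left; now apply exp_increasing | lra]. Qed.

Lemma exp_le_inv x y : exp x <= exp y -> x <= y.
Proof.
intros H. apply Rnot_lt_le. intros H'. apply exp_increasing in H'. lra.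
Qed.

Lemma pow_small x e : 0 <= x < 1 -> 0 < e -> exists N, forall n, (N <= n)%nat -> x ^ n < e.
Proof.
intros Hx He. destruct (pow_lt_1_zero x) with (y := e) as [N HN];
  [rewrite Rabs_right; lra | exact He |].
exists N. intros n Hn. specialize (HN n Hn). apply Rabs_def2 in HN. lra.
Qed.

Definition in_strip (k : Z) (z : Cx) : Prop :=
  (2 * IZR k - 1) * PI <= Im z < (2 * IZR k + 1) * PI.

Lemma exists_itinerary lam z : exists s, has_itinerary lam z s.
Proof.
(* The strips are centred at the multiples of 2 pi, hence the shift by 1/2. *)
exists (fun j => Int_part (Im (Eiter lam j z) / (2 * PI) + / 2)).
intros j. pose proof PI_RGT_0 as HPI.
destruct (base_Int_part (Im (Eiter lam j z) / (2 * PI) + / 2)) as [H1 H2].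
set (t := Im (Eiter lam j z) / (2 * PI)) in *.
set (k := IZR (Int_part (t + / 2))) in *.
replace (Im (Eiter lam j z)) with (2 * PI * t) by (unfold t; field; lra).
split; nra.
Qed.

Lemma Cnorm_Eexp lam p : 0 < lam -> Cnorm (Eexp lam p) = lam * exp (Re p).
Proof.
intros Hlam. unfold Cnorm, Eexp. cbn [Re Im fst snd].
replace (_ + _) with ((lam * exp (Re p)) ^ 2 * (Rsqr (sin (Im p)) + Rsqr (cos (Im p))))
  by (unfold Rsqr; ring).
rewrite sin2_cos2, Rmult_1_r. apply sqrt_pow2.
pose proof (exp_pos (Re p)). nra.
Qed.

Lemma Eiter_add lam i j z : Eiter lam (i + j) z = Eiter lam i (Eiter lam j z).
Proof. apply Nat.iter_add. Qed.

Lemma Eiter_continuous lam j z e : 0 < lam -> 0 < e ->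
  exists d, 0 < d /\ forall z', Cdist z' z < d ->
    Cdist (Eiter lam j z') (Eiter lam j z) < e.
Proof.
intros Hlam. revert e. induction j as [| j IH]; intros e He.
{ exists e. now split. }
set (u := Eiter lam j z) in *.
set (K := lam * exp (Re u + 1)).
assert (HK : 0 < K) by (apply Rmult_lt_0_compat; [exact Hlam | apply exp_pos]).
destruct (IH (Rmin 1 (e / K))) as (d & Hd & Hz).
{ apply Rmin_pos; [lra | now apply Rdiv_lt_0_compat]. }
exists d. split; [exact Hd |]. intros z' Hz'. specialize (Hz z' Hz').
pose proof (Rmin_l 1 (e / K)). pose proof (Rmin_r 1 (e / K)).
pose proof (Re_le_Cdist (Eiter lam j z') u) as Hre. apply Rabs_le_between in Hre.
apply Rle_lt_trans with (K * Cdist (Eiter lam j z') u).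
- apply Eexp_lip; lra.
- apply Rlt_le_trans with (K * (e / K)); [apply Rmult_lt_compat_l; lra | right; field; lra].
Qed.

(** * Expansion along itineraries *)

Section Expansion.

Context (lam beta : R) (lam_pos : 0 < lam) (beta_gt1 : 1 < beta)
  (beta_fix : lam * exp beta = beta).

Lemma beta_le_Re_pre p : beta <= Cnorm (Eexp lam p) -> beta <= Re p.
Proof.
intros H. rewrite Cnorm_Eexp in H by exact lam_pos.
apply exp_le_inv. apply Rmult_le_reg_l with lam; lra.
Qed.

(** As |E(p)| = lam e^(Re p) and lam e^beta = beta, the bound passes from a point to its preimage;
    so it need only be checked at late times. *)
Lemma beta_le_Re_orbit n j z : (j <= n)%nat ->
  beta <= Re (Eiter lam n z) -> beta <= Re (Eiter lam j z).
Proof.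
intros Hj; induction Hj as [| n Hj IH]; intros H; [exact H |].
apply IH, beta_le_Re_pre. eapply Rle_trans; [exact H |].
eapply Rle_trans; [apply Rle_abs | apply Re_le_Cnorm].
Qed.

(** The same branch [Llog lam k] recovers both points from their images, and it contracts by 1/beta
    on [Re >= beta]. *)
Lemma Eexp_expands k p q : in_strip k p -> in_strip k q ->
  beta <= Re (Eexp lam p) -> beta <= Re (Eexp lam q) ->
  Cdist p q <= / beta * Cdist (Eexp lam p) (Eexp lam q).
Proof.
intros Hp Hq Hp' Hq'.
rewrite <- (Llog_Eexp lam k p), <- (Llog_Eexp lam k q) at 1 by (assumption || lra).
apply Llog_lip; lra.
Qed.

Lemma Eiter_expands s n p q :
  (forall j, (j < n)%nat -> in_strip (s j) (Eiter lam j p)) ->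
  (forall j, (j < n)%nat -> in_strip (s j) (Eiter lam j q)) ->
  beta <= Re (Eiter lam n p) -> beta <= Re (Eiter lam n q) ->
  Cdist p q <= (/ beta) ^ n * Cdist (Eiter lam n p) (Eiter lam n q).
Proof.
induction n as [| n IH]; intros Hp Hq Rp Rq; [simpl; lra |].
assert (Hib : 0 < / beta) by (apply Rinv_0_lt_compat; lra).
eapply Rle_trans.
- apply IH; [intros j Hj; apply Hp; lia | intros j Hj; apply Hq; lia | |].
  + now apply (beta_le_Re_orbit (S n)); [lia |].
  + now apply (beta_le_Re_orbit (S n)); [lia |].
- replace ((/ beta) ^ S n) with ((/ beta) ^ n * / beta) by (simpl; ring).
  rewrite Rmult_assoc. apply Rmult_le_compat_l; [apply pow_le; lra |].
  apply (Eexp_expands (s n)); auto.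
Qed.

(** The branches [Llog lam (s j)] are applied for j = n - 1 down to 0. Each preimage again satisfies
    [Re >= beta], so the next branch is defined there; the bound pi/2 is that of [atan]. *)
Lemma exists_pullback (s : nat -> Z) n p : beta <= Re p ->
  exists z, Eiter lam n z = p /\
    forall j, (j < n)%nat -> Rabs (Im (Eiter lam j z) - 2 * PI * IZR (s j)) < PI / 2.
Proof.
revert p. induction n as [| n IH]; intros p Hp.
{ exists p. split; [reflexivity | lia]. }
assert (HE : Eexp lam (Llog lam (s n) p) = p) by (apply Eexp_Llog; lra).
destruct (IH (Llog lam (s n) p)) as (z & Hz & Hj).
{ apply beta_le_Re_pre. rewrite HE.
  eapply Rle_trans; [exact Hp |]. eapply Rle_trans; [apply Rle_abs | apply Re_le_Cnorm]. }
exists z. split.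
- change (Eexp lam (Eiter lam n z) = p). now rewrite Hz.
- intros j Hlt. destruct (Nat.eq_dec j n) as [-> | Hne]; [| apply Hj; lia].
  rewrite Hz. unfold Llog. cbn [Im snd].
  apply Rabs_def1; pose proof (atan_bound (Im p / Re p)); lra.
Qed.

Lemma half_strip k z : Rabs (Im z - 2 * PI * IZR k) <= PI / 2 -> in_strip k z.
Proof. intros H. apply Rabs_le_between in H. unfold in_strip. pose proof PI_RGT_0. lra. Qed.

(* [E] maps the line [Im = (2k + 1) pi] to the negative real axis, which it maps into [(0, beta)]. *)
Lemma bounded_orbit k p n : Im p = (2 * IZR k + 1) * PI -> (2 <= n)%nat ->
  Cnorm (Eiter lam n p) <= beta.
Proof.
intros Hp Hn.
assert (H : 0 <= Re (Eiter lam n p) <= beta /\ Im (Eiter lam n p) = 0).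
{ induction Hn as [| n Hn IH].
  - destruct (sin_cos_period_Z PI k) as [Hc Hs].
    replace (PI + 2 * PI * IZR k) with (Im p) in Hc, Hs by (rewrite Hp; ring).
    assert (HE : Eexp lam p = (- (lam * exp (Re p)), 0))
      by (unfold Eexp; rewrite Hc, Hs, cos_PI, sin_PI; f_equal; ring).
    change (Eiter lam 2 p) with (Eexp lam (Eexp lam p)). rewrite HE.
    unfold Eexp. cbn [Re Im fst snd]. rewrite cos_0, sin_0.
    pose proof (exp_pos (Re p)).
    assert (exp (- (lam * exp (Re p))) <= exp beta) by (apply exp_le; nra).
    pose proof (exp_pos (- (lam * exp (Re p)))).
    repeat split; nra.
  - change (Eiter lam (S n) p) with (Eexp lam (Eiter lam n p)).
    destruct IH as [IH1 IH2]. unfold Eexp. cbn [Re Im fst snd].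
    rewrite IH2, cos_0, sin_0.
    assert (exp (Re (Eiter lam n p)) <= exp beta) by (apply exp_le; lra).
    pose proof (exp_pos (Re (Eiter lam n p))).
    repeat split; nra. }
destruct H as [H1 H2]. apply Cnorm_le; [lra |]. rewrite H2. nra.
Qed.

End Expansion.

(** * Julia and Fatou points *)

(** This function on the sphere vanishes only at infinity, so it tells bounded orbits from large
    ones, even when the limit [g z] is unknown. *)
Definition height_defect (a : option Cx) : R :=
  match a with Some z => 2 / (1 + Cnorm z ^ 2) | None => 0 end.

(* [1 - height_defect] is the third coordinate of the stereographic projection. *)
Lemma height_defect_chordal z b :
  Rabs (height_defect (Some z) - height_defect b) <= chordal (Some z) b.
Proof.
pose proof (Cnorm_pos z) as Hz.
destruct b as [b |]; cbn [height_defect]; unfold chordal.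
- pose proof (Cnorm_pos b) as Hb.
  set (x := Cnorm z) in *. set (y := Cnorm b) in *.
  set (D := (1 + x ^ 2) * (1 + y ^ 2)).
  assert (HD : 0 < D) by (unfold D; apply Rmult_lt_0_compat; nra).
  assert (Hs : 0 < sqrt D) by now apply sqrt_lt_R0.
  assert (Hs2 : sqrt D * sqrt D = D) by (apply sqrt_sqrt; lra).
  (* (1 + x^2)(1 + y^2) = (x + y)^2 + (x y - 1)^2. *)
  assert (Hxy : x + y <= sqrt D).
  { apply Rsqr_incr_0_var; [| lra]. unfold Rsqr. rewrite Hs2. unfold D.
    pose proof (pow2_ge_0 (x * y - 1)). nra. }
  assert (Hd : Rabs (x - y) <= Cdist z b).
  { apply le_Cnorm. rewrite pow2_abs. cbn [Re Im fst snd].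
    pose proof (Cnorm_sq z) as E1. pose proof (Cnorm_sq b) as E2. fold x in E1. fold y in E2.
    assert (Hcs : Re z * Re b + Im z * Im b <= x * y); [| nra].
    apply Rsqr_incr_0_var; [| nra]. unfold Rsqr.
    replace (x * y * (x * y)) with (x ^ 2 * y ^ 2) by ring. rewrite E1, E2.
    pose proof (pow2_ge_0 (Re z * Im b - Im z * Re b)). nra. }
  replace (2 / (1 + x ^ 2) - 2 / (1 + y ^ 2)) with (2 * ((y - x) * (x + y)) / D)
    by (unfold D; field; split; nra).
  unfold Rdiv. rewrite Rabs_mult, Rabs_mult, Rabs_mult.
  rewrite (Rabs_right 2) by lra. rewrite (Rabs_right (x + y)) by lra.
  rewrite (Rabs_right (/ D)) by (apply Rle_ge, Rlt_le, Rinv_0_lt_compat, HD).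
  rewrite Rabs_minus_sym.
  replace (2 * Cdist z b * / sqrt D) with (2 * (Cdist z b * sqrt D) * / D)
    by (rewrite <- Hs2 at 2; field; lra).
  apply Rmult_le_compat_r; [apply Rlt_le, Rinv_0_lt_compat, HD |].
  apply Rmult_le_compat_l; [lra |].
  apply Rmult_le_compat; [apply Rabs_pos | lra | exact Hd | exact Hxy].
- set (x := Cnorm z) in *. rewrite Rminus_0_r.
  set (D := 1 + x ^ 2). assert (HD : 1 <= D) by (unfold D; nra).
  rewrite Rabs_right by (apply Rle_ge, Rlt_le, Rdiv_lt_0_compat; lra).
  unfold Rdiv. apply Rmult_le_compat_l; [lra |].
  apply Rinv_le_contravar; [apply sqrt_lt_R0; lra |].
  rewrite <- (sqrt_pow2 D) at 2 by lra. apply sqrt_le_1; nra.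
Qed.

Lemma le_strictly_increasing_nat (phi : nat -> nat) k :
  (forall i, (phi i < phi (S i))%nat) -> (k <= phi k)%nat.
Proof. intros H. induction k as [| k IH]; [lia |]. specialize (H k). lia. Qed.

Section JuliaFatou.

Context (lam beta : R) (lam_pos : 0 < lam) (beta_gt1 : 1 < beta)
  (beta_fix : lam * exp beta = beta).

(* Pulling back points of the lines [Im = (2k + 1) pi] next to the orbit of [w] gives points
   arbitrarily close to [w] with bounded orbits. *)
Lemma escaping_Julia w :
  (forall j, beta <= Re (Eiter lam j w)) ->
  (forall M, exists n0, forall n, (n0 <= n)%nat -> M <= Re (Eiter lam n w)) ->
  Julia lam w.
Proof.
intros Hre Hesc (r & Hr & Hnorm).
destruct (exists_itinerary lam w) as [s Hs].
destruct (Hnorm (fun n => n)) as (phi & g & Hphi & Hg).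
assert (Hib : 0 < / beta < 1)
  by (split; [apply Rinv_0_lt_compat; lra | rewrite <- Rinv_1; apply Rinv_lt_contravar; lra]).
(* With this [e], a point of norm at most beta has defect at least 8e. At one [z] the defect will be
   below e at time [phi k] and at least 8e at time [phi l], although both are within e of that of
   [g z]. *)
set (e := / (4 * (1 + beta ^ 2))).
assert (He : 0 < e) by (apply Rinv_0_lt_compat; nra).
assert (He8 : 2 / (1 + beta ^ 2) = 8 * e) by (unfold e; field; nra).
destruct (Hg (r / 2) ltac:(lra) e He) as [K HK].
set (M := 2 / e + 1).
assert (HM : 0 < 2 / e) by (apply Rdiv_lt_0_compat; lra).
destruct (Hesc (M + 1)) as [n0 Hn0].
(* At time [phi k] every point close enough to [w] is still near the orbit of [w], hence large. *)
set (k := max K n0).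
assert (Hk : (K <= k /\ n0 <= phi k)%nat).
{ pose proof (le_strictly_increasing_nat phi k Hphi). unfold k in *. lia. }
destruct (Eiter_continuous lam (phi k) w 1 lam_pos ltac:(lra)) as (d & Hd & Hcont).
destruct (pow_small (/ beta) (Rmin d (r / 2) / (2 * PI))) as [n Hn].
{ lra. }
{ pose proof PI_RGT_0. apply Rdiv_lt_0_compat; [apply Rmin_pos; lra | lra]. }
specialize (Hn n (le_n n)).
(* [p] lies on the upper edge of the strip of E^n(w), straight above E^n(w), so their distance is at
   most 2 pi. *)
set (p := (Re (Eiter lam n w), (2 * IZR (s n) + 1) * PI) : Cx).
destruct (exists_pullback lam beta lam_pos beta_gt1 beta_fix s n p (Hre n)) as (z & Hzp & Hz).
assert (Hzw : Cdist z w <= (/ beta) ^ n * (2 * PI)).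
{ eapply Rle_trans.
  - apply (Eiter_expands lam beta) with (s := s) (n := n); try assumption.
    + intros j Hj. apply half_strip, Rlt_le, Hz, Hj.
    + intros j _. apply Hs.
    + rewrite Hzp. apply Hre.
    + apply Hre.
  - apply Rmult_le_compat_l; [apply pow_le; lra |].
    rewrite Hzp. eapply Rle_trans; [apply Cdist_le_sum |]. cbn [Re Im fst snd p].
    specialize (Hs n). rewrite Rminus_diag, Rabs_R0, Rabs_right; lra. }
assert (Hzd : Cdist z w < Rmin d (r / 2)).
{ eapply Rle_lt_trans; [exact Hzw |]. pose proof PI_RGT_0.
  apply Rlt_le_trans with (Rmin d (r / 2) / (2 * PI) * (2 * PI));
    [apply Rmult_lt_compat_r; lra | right; field; lra]. }
pose proof (Rmin_l d (r / 2)). pose proof (Rmin_r d (r / 2)).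
(* By time n + 2 the orbit of [z] has been bounded by beta. *)
set (l := max K (n + 2)).
assert (Hl : (K <= l /\ n + 2 <= phi l)%nat).
{ pose proof (le_strictly_increasing_nat phi l Hphi). unfold l in *. lia. }
pose proof (HK k (proj1 Hk) z ltac:(lra)) as Hck.
pose proof (HK l (proj1 Hl) z ltac:(lra)) as Hcl.
pose proof (height_defect_chordal (Eiter lam (phi k) z) (g z)) as Hak.
pose proof (height_defect_chordal (Eiter lam (phi l) z) (g z)) as Hal.
apply (fun H => Rle_lt_trans _ _ _ H Hck) in Hak. apply Rabs_def2 in Hak.
apply (fun H => Rle_lt_trans _ _ _ H Hcl) in Hal. apply Rabs_def2 in Hal.
cbn [height_defect] in Hak, Hal.
assert (Hbig : 2 / (1 + Cnorm (Eiter lam (phi k) z) ^ 2) < e).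
{ set (y := Cnorm (Eiter lam (phi k) z)).
  assert (Hy : M <= y).
  { specialize (Hcont z ltac:(lra)). specialize (Hn0 (phi k) (proj2 Hk)).
    pose proof (Re_le_Cdist (Eiter lam (phi k) z) (Eiter lam (phi k) w)) as H1.
    pose proof (Re_le_Cnorm (Eiter lam (phi k) z)) as H2. fold y in H2.
    apply Rabs_le_between in H1. apply Rabs_le_between in H2. lra. }
  apply Rmult_lt_reg_r with (1 + y ^ 2); [nra |].
  replace (2 / (1 + y ^ 2) * (1 + y ^ 2)) with 2 by (field; nra).
  assert (y <= 1 + y ^ 2) by nra.
  apply Rlt_le_trans with (e * M);
    [unfold M; replace (e * (2 / e + 1)) with (2 + e) by (field; lra); lra |].
  apply Rmult_le_compat_l; lra. }
assert (Hsmall : 8 * e <= 2 / (1 + Cnorm (Eiter lam (phi l) z) ^ 2)).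
{ set (y := Cnorm (Eiter lam (phi l) z)).
  assert (Hy : 0 <= y <= beta).
  { split; [apply Cnorm_pos |]. unfold y.
    replace (phi l) with ((phi l - n) + n)%nat by lia.
    rewrite Eiter_add, Hzp.
    apply (bounded_orbit lam beta lam_pos beta_gt1 beta_fix (s n)); [reflexivity | lia]. }
  rewrite <- He8. unfold Rdiv. apply Rmult_le_compat_l; [lra |].
  apply Rinv_le_contravar; nra. }
lra.
Qed.

End JuliaFatou.

(** * The basin of the attracting fixed point *)

Lemma mul_exp_1_lt_1 lam : lam < exp (-1) -> lam * exp 1 < 1.
Proof.
intros H. replace 1 with (exp (-1) * exp 1) at 2
  by (rewrite <- exp_plus; replace (-1 + 1) with 0 by ring; apply exp_0).
apply Rmult_lt_compat_r; [apply exp_pos | exact H].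
Qed.

Lemma exists_attracting_fixpoint lam : 0 < lam -> lam < exp (-1) ->
  exists alpha, 0 < alpha < 1 /\ lam * exp alpha = alpha.
Proof.
intros Hlam Hle.
pose proof (mul_exp_1_lt_1 lam Hle) as H1.
destruct (IVT_cor (fun x => x - lam * exp x) 0 1) as (a & Ha & Ha0).
- intros x. apply derivable_continuous_pt, derivable_pt_minus; [apply derivable_pt_id |].
  apply derivable_pt_scal, derivable_pt_exp.
- lra.
- rewrite exp_0. nra.
- pose proof (exp_pos a). exists a. split; [| lra].
  split; [nra |]. destruct Ha as [_ [Ha | ->]]; lra.
Qed.

(** Normality is asked for every sequence [m] of exponents, repetitions allowed: either some iterate
    recurs forever, or the exponents tend to infinity. *)
Lemma nat_seq_cases (m : nat -> nat) :
  (exists v, forall K, exists k, (K <= k)%nat /\ m k = v) \/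
  (forall M, exists K, forall k, (K <= k)%nat -> (M <= m k)%nat).
Proof.
destruct (classic (exists v, forall K, exists k, (K <= k)%nat /\ m k = v)) as [H | H]; [now left |].
right. induction M as [| M [K HK]]; [exists 0%nat; lia |].
destruct (classic (exists K', forall k, (K' <= k)%nat -> m k <> M)) as [[K' HK'] | HK'].
- exists (max K K'). intros k Hk. specialize (HK k ltac:(lia)). specialize (HK' k ltac:(lia)). lia.
- exfalso. apply H. exists M. intros K'. apply NNPP. intros Hn. apply HK'.
  exists K'. intros k Hk Hm. apply Hn. now exists k.
Qed.

Lemma exists_constant_subsequence (m : nat -> nat) v :
  (forall K, exists k, (K <= k)%nat /\ m k = v) ->
  exists phi : nat -> nat, (forall k, (phi k < phi (S k))%nat) /\ forall k, m (phi k) = v.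
Proof.
intros H.
pose (f := fun K => proj1_sig (constructive_indefinite_description _ (H K))).
assert (Hf : forall K, (K <= f K)%nat /\ m (f K) = v)
  by (intros K; exact (proj2_sig (constructive_indefinite_description _ (H K)))).
exists (fix phi k := match k with O => f 0%nat | S k => f (S (phi k)) end). split.
- intros k. apply Hf.
- intros [| k]; apply Hf.
Qed.

Lemma chordal_le_Cdist z w : chordal (Some z) (Some w) <= 2 * Cdist z w.
Proof.
unfold chordal. set (D := (1 + Cnorm z ^ 2) * (1 + Cnorm w ^ 2)).
assert (HD : 1 <= sqrt D).
{ rewrite <- sqrt_1. apply sqrt_le_1_alt. unfold D. nra. }
pose proof (Cdist_pos z w).
apply Rmult_le_reg_r with (sqrt D); [lra |].
replace (2 * Cdist z w / sqrt D * sqrt D) with (2 * Cdist z w) by (field; lra). nra.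
Qed.

(* [E] contracts the half-plane [Re <= 1], hence its iterates converge there to the attracting
   fixed point. *)
Lemma Julia_Re_ge_1 lam z j : 0 < lam -> lam < exp (-1) ->
  Julia lam z -> 1 <= Re (Eiter lam j z).
Proof.
intros Hlam Hle HJ. apply Rnot_lt_le. intros Hlt. apply HJ. clear HJ.
destruct (exists_attracting_fixpoint lam Hlam Hle) as (alpha & Halpha & Hfix).
set (kap := lam * exp 1).
assert (Hkap : 0 < kap < 1)
  by (split; [apply Rmult_lt_0_compat; [exact Hlam | apply exp_pos] | now apply mul_exp_1_lt_1]).
assert (Hnext : forall u, Re u <= 1 -> Cnorm (Eexp lam u) <= kap).
{ intros u Hu. rewrite Cnorm_Eexp by exact Hlam. unfold kap.
  apply Rmult_le_compat_l; [lra | now apply exp_le]. }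
assert (HEa : Eexp lam (alpha, 0) = (alpha, 0)).
{ unfold Eexp. cbn [Re Im fst snd]. rewrite cos_0, sin_0, Hfix. f_equal; ring. }
destruct (Eiter_continuous lam j z (1 - Re (Eiter lam j z)) Hlam ltac:(lra)) as (d & Hd & Hcont).
(* The constant 3 bounds the initial distance to the fixed point: at most 2 in the real part and
   [kap < 1] in the imaginary part. *)
assert (Horb : forall z', Cdist z' z < d -> forall i,
  Re (Eiter lam (i + S j) z') <= 1 /\
  Cdist (Eiter lam (i + S j) z') (alpha, 0) <= kap ^ i * 3).
{ intros z' Hz'. specialize (Hcont z' Hz').
  assert (H0 : Cnorm (Eiter lam (S j) z') <= kap).
  { apply (Hnext (Eiter lam j z')). pose proof (Re_le_Cdist (Eiter lam j z') (Eiter lam j z)) as H1.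
    apply Rabs_le_between in H1. lra. }
  induction i as [| i [IH1 IH2]].
  - pose proof (Re_le_Cnorm (Eiter lam (S j) z')) as H1.
    pose proof (Im_le_Cnorm (Eiter lam (S j) z')) as H2.
    change (0 + S j)%nat with (S j). apply Rabs_le_between in H1. split; [lra |].
    eapply Rle_trans; [apply Cdist_le_sum |]. cbn [Re Im fst snd pow].
    fold (Re (Eiter lam (S j) z')). fold (Im (Eiter lam (S j) z')).
    rewrite Rminus_0_r.
    assert (Rabs (Re (Eiter lam (S j) z') - alpha) <= 2) by (apply Rabs_le; lra). lra.
  - change (S i + S j)%nat with (S (i + S j)).
    change (Eiter lam (S (i + S j)) z') with (Eexp lam (Eiter lam (i + S j) z')).
    split.
    + pose proof (Hnext _ IH1) as H1.
      pose proof (Re_le_Cnorm (Eexp lam (Eiter lam (i + S j) z'))) as H2.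
      apply Rabs_le_between in H2. lra.
    + rewrite <- HEa. eapply Rle_trans; [apply Eexp_lip with (c := 1); [exact Hlam | exact IH1 | cbn [Re fst]; lra] |].
      fold kap. simpl pow. rewrite Rmult_assoc. apply Rmult_le_compat_l; [lra | exact IH2]. }
exists d. split; [exact Hd |]. intros m.
destruct (nat_seq_cases m) as [[v Hv] | Hm].
(* A recurring iterate is the limit of its own constant subsequence; otherwise the limit is the
   attracting fixed point. *)
- destruct (exists_constant_subsequence m v Hv) as (phi & Hphi & Hphiv).
  exists phi, (fun u => Some (Eiter lam v u)). split; [exact Hphi |].
  intros rho Hrho e He. exists 0%nat. intros k _ u _. rewrite Hphiv.
  eapply Rle_lt_trans; [apply chordal_le_Cdist |]. rewrite Cdist_refl. lra.
- exists (fun k => k), (fun _ => Some (alpha, 0)). split; [lia |].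
  intros rho Hrho e He.
  destruct (pow_small kap (e / 6)) as [n Hn]; [lra | lra |].
  destruct (Hm (n + S j)%nat) as [K HK].
  exists K. intros k Hk u Hu. specialize (HK k Hk).
  eapply Rle_lt_trans; [apply chordal_le_Cdist |].
  destruct (Horb u ltac:(lra) (m k - S j)%nat) as [_ Hb].
  replace (m k - S j + S j)%nat with (m k) in Hb by lia.
  specialize (Hn (m k - S j)%nat ltac:(lia)). lra.
Qed.

(** * Orbits with a prescribed itinerary and growth *)

Section Shadowing.

Context (lam beta : R) (lam_pos : 0 < lam) (beta_gt1 : 1 < beta)
  (beta_fix : lam * exp beta = beta).
Context (s : nat -> Z) (t : nat -> R) (N : nat).
Context (t_rec : forall n, (N <= n)%nat -> t (S n) = lam * exp (t n))
  (t_ge_2 : forall n, (N <= n)%nat -> 2 <= t n)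
  (t_ge_beta : forall n, (N <= n)%nat -> beta <= t n)
  (s_le_t : forall n, (N <= n)%nat -> Rabs (2 * PI * IZR (s n)) <= t n).

Definition half_strip_box (n : nat) (p : Cx) : Prop :=
  t n <= Re p <= t n + 2 /\ Rabs (Im p - 2 * PI * IZR (s n)) <= PI / 2.

(** Write T for [t (S n)]. In the box, |E(p)| lies between T and (T + 2) + (T + 2), which is at most
    4T because T >= 2. As e^2 >= 4, taking logarithms gives real parts between [t n] and
    [t n + 2]. *)
Lemma half_strip_box_pre n p : (N <= n)%nat ->
  Rabs (Im p - 2 * PI * IZR (s n)) <= PI / 2 ->
  half_strip_box (S n) (Eexp lam p) -> half_strip_box n p.
Proof.
intros Hn Him [Hre' Him']. split; [| exact Him].
pose proof (Cnorm_Eexp lam p lam_pos) as HE.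
pose proof (Re_le_Cnorm (Eexp lam p)) as H1.
pose proof (Cnorm_le_sum (Eexp lam p)) as H2.
pose proof (t_ge_2 (S n) ltac:(lia)) as Ht2.
pose proof (s_le_t (S n) ltac:(lia)) as Hst.
rewrite (Rabs_right (Re (Eexp lam p))) in H1, H2 by lra.
rewrite t_rec in * by exact Hn.
pose proof PI_4.
apply Rabs_le_between in Him'. apply Rabs_le_between in Hst.
assert (Him2 : Rabs (Im (Eexp lam p)) <= lam * exp (t n) + 2) by (apply Rabs_le; lra).
split.
- apply exp_le_inv, Rmult_le_reg_l with lam; lra.
- apply exp_le_inv, Rmult_le_reg_l with lam; [exact lam_pos |].
  rewrite exp_plus.
  assert (4 <= exp 2).
  { replace 2 with (1 + 1) by ring. rewrite exp_plus. pose proof (exp_ineq1_le 1). nra. }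
  pose proof (exp_pos (t n)). nra.
Qed.

(** Points of the boxes at times N + m are pulled back to time 0. Expansion makes these pullbacks a
    Cauchy sequence, and its limit is the required point. The bound pi/2 on the imaginary part is
    closed and well inside the half-open strip, so the itinerary survives the limit. *)
Lemma exists_shadow : exists z, has_itinerary lam z s /\
  forall n, (N <= n)%nat -> t n <= Re (Eiter lam n z) <= t n + 2.
Proof.
pose (q := fun m => (t (N + m)%nat, 2 * PI * IZR (s (N + m)%nat)) : Cx).
assert (Hq : forall m, half_strip_box (N + m) (q m)).
{ intros m. unfold half_strip_box, q. cbn [Re Im fst snd].
  rewrite Rminus_diag, Rabs_R0. pose proof PI_RGT_0. lra. }
assert (Hw : forall m, exists z, Eiter lam (N + m) z = q m /\ forall j, (j < N + m)%nat ->
  Rabs (Im (Eiter lam j z) - 2 * PI * IZR (s j)) < PI / 2).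
{ intros m. apply (exists_pullback lam beta); try assumption. cbn. apply t_ge_beta. lia. }
pose (w := fun m => proj1_sig (constructive_indefinite_description _ (Hw m))).
assert (Hwq : forall m, Eiter lam (N + m) (w m) = q m)
  by (intros m; apply (proj2_sig (constructive_indefinite_description _ (Hw m)))).
assert (Him : forall m j, (j <= N + m)%nat ->
  Rabs (Im (Eiter lam j (w m)) - 2 * PI * IZR (s j)) <= PI / 2).
{ intros m j Hj. destruct (Nat.eq_dec j (N + m)) as [-> | Hne].
  - rewrite Hwq. apply Hq.
  - apply Rlt_le, (proj2_sig (constructive_indefinite_description _ (Hw m))). lia. }
assert (Hbox : forall m j, (N <= j <= N + m)%nat -> half_strip_box j (Eiter lam j (w m))).
{ intros m j Hj.
  (* Downward induction on [j], from the final box back to time [N]. *)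
  replace j with (N + m - (N + m - j))%nat by lia.
  assert (Hi : (N + m - j <= m)%nat) by lia. revert Hi.
  generalize (N + m - j)%nat as i. induction i as [| i IH]; intros Hi.
  - rewrite Nat.sub_0_r, Hwq. apply Hq.
  - apply half_strip_box_pre; [lia | apply Him; lia |].
    specialize (IH ltac:(lia)). revert IH.
    now replace (N + m - i)%nat with (S (N + m - S i)) by lia. }
assert (Hib : 0 < / beta < 1)
  by (split; [apply Rinv_0_lt_compat; lra | rewrite <- Rinv_1; apply Rinv_lt_contravar; lra]).
(* Two points of one box differ by at most 2 in the real part and pi <= 4 in the imaginary part,
   hence the 6. *)
assert (Hclose : forall m m', (m <= m')%nat -> Cdist (w m) (w m') <= (/ beta) ^ m * 6).
{ intros m m' Hmm.
  destruct (Hbox m (N + m)%nat ltac:(lia)) as [Hr1 Hi1].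
  destruct (Hbox m' (N + m)%nat ltac:(lia)) as [Hr2 Hi2].
  pose proof (t_ge_beta (N + m)%nat ltac:(lia)).
  eapply Rle_trans.
  - apply (Eiter_expands lam beta) with (s := s) (n := (N + m)%nat); try assumption;
      try lra; intros j Hj; apply half_strip, Him; lia.
  - rewrite pow_add, Rmult_assoc, (Rmult_comm _ (_ * _)), Rmult_assoc.
    apply Rmult_le_compat_l; [apply pow_le; lra |].
    apply Rle_trans with (6 * 1); [| lra].
    apply Rmult_le_compat; [apply Cdist_pos | apply pow_le; lra | |
      rewrite <- (pow1 N); apply pow_incr; lra].
    eapply Rle_trans; [apply Cdist_le_sum |].
    pose proof PI_4. apply Rabs_le_between in Hi1. apply Rabs_le_between in Hi2.
    apply Rle_trans with (2 + 4); [| lra].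
    apply Rplus_le_compat; apply Rabs_le; lra. }
assert (Hcauchy : forall f : Cx -> R, (forall z z', Rabs (f z - f z') <= Cdist z z') ->
  {l | Un_cv (fun m => f (w m)) l}).
{ intros f Hf. apply Rcomplete.R_complete. intros e He.
  destruct (pow_small (/ beta) (e / 6)) as [K HK]; [lra | lra |].
  exists K.
  assert (Hle : forall m m', (K <= m)%nat -> (m <= m')%nat -> Rabs (f (w m) - f (w m')) < e).
  { intros m m' Hm Hmm. eapply Rle_lt_trans; [apply Hf |].
    eapply Rle_lt_trans; [now apply Hclose |]. specialize (HK m Hm). lra. }
  intros m m' Hm Hm'. unfold Rdist.
  destruct (Nat.le_ge_cases m m'); [| rewrite Rabs_minus_sym]; apply Hle; lia. }
destruct (Hcauchy Re Re_le_Cdist) as [x Hx].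
destruct (Hcauchy Im Im_le_Cdist) as [y Hy].
set (z := (x, y) : Cx).
assert (Happ : forall j e, 0 < e ->
  exists m, (j <= N + m)%nat /\ Cdist (Eiter lam j (w m)) (Eiter lam j z) < e).
{ intros j e He.
  destruct (Eiter_continuous lam j z e lam_pos He) as (d & Hd & Hcont).
  destruct (Hx (d / 2) ltac:(lra)) as [K1 HK1].
  destruct (Hy (d / 2) ltac:(lra)) as [K2 HK2].
  exists (max j (max K1 K2)). split; [lia |]. apply Hcont.
  specialize (HK1 (max j (max K1 K2)) ltac:(lia)).
  specialize (HK2 (max j (max K1 K2)) ltac:(lia)).
  unfold Rdist in HK1, HK2.
  eapply Rle_lt_trans; [apply Cdist_le_sum |]. cbn [Re Im fst snd z]. unfold Re, Im in *. lra. }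
exists z. split.
- intros j. apply half_strip, le_epsilon. intros e He.
  destruct (Happ j e He) as (m & Hm & Hd). specialize (Him m j Hm).
  pose proof (Im_le_Cdist (Eiter lam j (w m)) (Eiter lam j z)) as H.
  apply Rabs_le_between in H. apply Rabs_le_between in Him. apply Rabs_le. lra.
- intros j Hj.
  assert (Hjm : forall e, 0 < e -> t j <= Re (Eiter lam j z) + e /\
                                   Re (Eiter lam j z) <= t j + 2 + e).
  { intros e He. destruct (Happ j e He) as (m & Hm & Hd).
    destruct (Hbox m j ltac:(lia)) as [Hb _].
    pose proof (Re_le_Cdist (Eiter lam j (w m)) (Eiter lam j z)) as H.
    apply Rabs_le_between in H. lra. }
  split; apply le_epsilon; intros e He; apply Hjm, He.
Qed.

End Shadowing.

(** * The function [S] *)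

Section FractionalIterates.

Context (lam beta : R) (lam_pos : 0 < lam) (beta_gt1 : 1 < beta)
  (beta_fix : lam * exp beta = beta).

Lemma Eriter_lt n x y : x < y -> Eriter lam n x < Eriter lam n y.
Proof.
intros H. induction n as [| n IH]; [exact H |].
apply Rmult_lt_compat_l; [exact lam_pos | now apply exp_increasing].
Qed.

(** E(v) - E(u) = E(u) (e^(v - u) - 1), where E(u) >= beta and e^h - 1 >= h. *)
Lemma Eriter_expands n x y : beta <= x -> x <= y ->
  beta <= Eriter lam n x /\ beta ^ n * (y - x) <= Eriter lam n y - Eriter lam n x.
Proof.
intros Hx Hxy. induction n as [| n [IH1 IH2]]; [simpl; lra |].
change (Eriter lam (S n) x) with (lam * exp (Eriter lam n x)).
change (Eriter lam (S n) y) with (lam * exp (Eriter lam n y)).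
set (u := Eriter lam n x) in *. set (v := Eriter lam n y) in *.
assert (Hu : beta <= lam * exp u).
{ rewrite <- beta_fix at 1. apply Rmult_le_compat_l; [lra | now apply exp_le]. }
split; [exact Hu |].
assert (Huv : 0 <= v - u).
{ eapply Rle_trans; [| exact IH2]. apply Rmult_le_pos; [apply pow_le |]; lra. }
replace (lam * exp v - lam * exp u) with (lam * exp u * (exp (v - u) - 1)).
- apply Rle_trans with (beta * (v - u)).
  + simpl pow. rewrite Rmult_assoc. apply Rmult_le_compat_l; lra.
  + pose proof (exp_ineq1_le (v - u)). apply Rmult_le_compat; lra.
- replace (exp v) with (exp u * exp (v - u)) by (rewrite <- exp_plus; f_equal; ring). ring.
Qed.

Lemma Eriter_unbounded x M : beta < x ->
  exists n0, forall n, (n0 <= n)%nat -> M <= Eriter lam n x.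
Proof.
intros Hx. destruct (Pow_x_infinity beta) with (b := Rmax 0 M / (x - beta)) as [n0 Hn0].
{ rewrite Rabs_right; lra. }
exists n0. intros n Hn. specialize (Hn0 n Hn).
rewrite Rabs_right in Hn0 by (apply Rle_ge, pow_le; lra).
destruct (Eriter_expands n beta x) as [H1 H2]; [lra | lra |].
assert (Rmax 0 M <= beta ^ n * (x - beta)).
{ replace (Rmax 0 M) with (Rmax 0 M / (x - beta) * (x - beta)) by (field; lra).
  apply Rmult_le_compat_r; lra. }
pose proof (Rmax_r 0 M). lra.
Qed.

Context (F : R -> R) (F_eq : forall x, F (beta * x) = lam * exp (F x))
  (F_0 : F 0 = beta) (F_diff : derivable_pt_lim F 0 1).

Lemma F_iter n x : F (beta ^ n * x) = Eriter lam n (F x).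
Proof.
induction n as [| n IH]; [simpl; f_equal; ring |].
simpl pow. rewrite Rmult_assoc, F_eq, IH. reflexivity.
Qed.

(** Dividing [x] and [y] by a large power of beta brings them near 0, where F(h) = beta + h + o(h);
    the functional equation transports this back through E^n. So facts about F reduce to its
    derivative at 0 and to facts about E^n. *)
Lemma F_scaled_increment x y eta : 0 < eta ->
  exists n x' y', F x = Eriter lam n (F x') /\ F y = Eriter lam n (F y') /\ y = beta ^ n * y' /\
    x - y - eta * (Rabs x + Rabs y) <= beta ^ n * (F x' - F y').
Proof.
intros Heta.
destruct (F_diff eta Heta) as [[d Hd] Hlin]. simpl in Hlin.
assert (Hlin' : forall h, Rabs h < d -> Rabs (F h - beta - h) <= eta * Rabs h).
{ intros h Hh. destruct (Req_dec h 0) as [-> | Hh0].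
  - rewrite F_0, Rminus_diag, Rminus_0_r, Rabs_R0. lra.
  - specialize (Hlin h Hh0 Hh). rewrite Rplus_0_l, F_0 in Hlin.
    replace (F h - beta - h) with (((F h - beta) / h - 1) * h) by (field; exact Hh0).
    rewrite Rabs_mult. apply Rmult_le_compat_r; [apply Rabs_pos | lra]. }
destruct (Pow_x_infinity beta) with (b := (Rabs x + Rabs y + 1) / d) as [n Hn].
{ rewrite Rabs_right; lra. }
specialize (Hn n (le_n n)).
set (B := beta ^ n) in *.
assert (HB : 0 < B) by (apply pow_lt; lra).
rewrite (Rabs_right B) in Hn by lra.
pose proof (Rabs_pos x). pose proof (Rabs_pos y).
assert (HBd : Rabs x + Rabs y + 1 <= B * d).
{ replace (Rabs x + Rabs y + 1) with ((Rabs x + Rabs y + 1) / d * d) by (field; lra).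
  apply Rmult_le_compat_r; lra. }
assert (Hdiv : forall u, Rabs (u / B) = Rabs u / B).
{ intros u. unfold Rdiv. rewrite Rabs_mult. f_equal.
  apply Rabs_right, Rle_ge, Rlt_le, Rinv_0_lt_compat, HB. }
assert (Hsmall : forall u, Rabs u < B * d -> Rabs (u / B) < d).
{ intros u Hu. rewrite Hdiv. apply Rmult_lt_reg_r with B; [exact HB |].
  replace (Rabs u / B * B) with (Rabs u) by (field; lra). lra. }
exists n, (x / B), (y / B).
rewrite <- !F_iter. fold B.
replace (B * (x / B)) with x by (field; lra).
replace (B * (y / B)) with y by (field; lra).
repeat split; try reflexivity.
pose proof (Hlin' (x / B) (Hsmall x ltac:(lra))) as H1.
pose proof (Hlin' (y / B) (Hsmall y ltac:(lra))) as H2.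
rewrite Hdiv in H1, H2. apply Rabs_le_between in H1. apply Rabs_le_between in H2.
replace (x - y - eta * (Rabs x + Rabs y))
  with (B * (x / B - y / B - eta * (Rabs x / B) - eta * (Rabs y / B))) by (field; lra).
apply Rmult_le_compat_l; lra.
Qed.

Lemma F_increasing x y : y < x -> F y < F x.
Proof.
intros Hxy.
pose proof (Rabs_pos x). pose proof (Rabs_pos y).
set (D := Rabs x + Rabs y + 1). assert (HD : 0 < D) by (unfold D; lra).
(* This tolerance leaves the positive lower bound (x - y) / D for the scaled increment. *)
destruct (F_scaled_increment x y ((x - y) / D)) as (n & x' & y' & -> & -> & _ & Hn).
{ apply Rdiv_lt_0_compat; lra. }
apply Eriter_lt.
assert (HB : 0 < beta ^ n) by (apply pow_lt; lra).
assert (Hpos : 0 < beta ^ n * (F x' - F y')).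
{ eapply Rlt_le_trans; [| exact Hn].
  replace (x - y - (x - y) / D * (Rabs x + Rabs y)) with ((x - y) / D)
    by (unfold D in *; field; lra).
  apply Rdiv_lt_0_compat; lra. }
apply Rnot_le_lt. intros Hle. nra.
Qed.

Lemma F_increasing_inv x y : F y <= F x -> y <= x.
Proof. intros H. apply Rnot_lt_le. intros H'. apply F_increasing in H'. lra. Qed.

Lemma F_ge_beta x : 0 <= x -> beta <= F x.
Proof. intros [H | <-]; [left; rewrite <- F_0; now apply F_increasing | lra]. Qed.

(** Above beta, E^n expands by at least beta^n, which cancels the scaling; the remaining
    linearization error is at most an arbitrary [e]. *)
Lemma F_expands x y : 0 <= y -> y <= x -> x - y <= F x - F y.
Proof.
intros Hy [Hxy | ->]; [| lra].
apply le_epsilon. intros e He.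
destruct (F_scaled_increment x y (e / (x + y + 1))) as (n & x' & y' & Hx' & Hy' & Hyy & Hn).
{ apply Rdiv_lt_0_compat; lra. }
assert (HB : 0 < beta ^ n) by (apply pow_lt; lra).
assert (Hy0 : 0 <= y') by (apply Rmult_le_reg_l with (beta ^ n); lra).
assert (Hlt : F y' <= F x').
{ apply Rnot_lt_le. intros H. apply (Eriter_lt n) in H.
  pose proof (F_increasing x y Hxy). lra. }
destruct (Eriter_expands n (F y') (F x') (F_ge_beta y' Hy0) Hlt) as [_ Hexp].
rewrite Hx', Hy'.
rewrite !Rabs_right in Hn by lra.
assert (e / (x + y + 1) * (x + y) <= e); [| lra].
apply Rle_trans with (e / (x + y + 1) * (x + y + 1)); [| right; field; lra].
apply Rmult_le_compat_l; [apply Rlt_le, Rdiv_lt_0_compat |]; lra.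
Qed.

End FractionalIterates.

(** * Hairs *)

Lemma continuity_pt_eps_delta (f : R -> R) t :
  (forall e, 0 < e -> exists d, 0 < d /\ forall u, Rabs (u - t) < d -> Rabs (f u - f t) < e) ->
  continuity_pt f t.
Proof.
intros H e He. destruct (H e He) as (d & Hd & Hf).
exists d. split; [exact Hd |]. intros u [_ Hu]. now apply Hf.
Qed.

Lemma Re_lower_bound_in_strip k z : in_strip k z -> 0 <= Re z ->
  Cnorm z - (2 * Rabs (IZR k) + 1) * PI <= Re z.
Proof.
intros Hk Hre. unfold in_strip in Hk. pose proof (Cnorm_le_sum z) as H.
rewrite (Rabs_right (Re z)) in H by lra.
assert (Rabs (Im z) <= (2 * Rabs (IZR k) + 1) * PI); [| lra].
pose proof (Rle_abs (IZR k)). pose proof (Rle_abs (- IZR k)) as H'. rewrite Rabs_Ropp in H'.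
pose proof PI_RGT_0. apply Rabs_le. split; nra.
Qed.

Section HairRay.

Context (lam beta : R) (lam_pos : 0 < lam) (lam_small : lam < exp (-1))
  (beta_gt1 : 1 < beta) (beta_fix : lam * exp beta = beta).
Context (s : nat -> Z) (gamma : R -> Cx)
  (gamma_cont : forall t, 0 <= t -> forall e, 0 < e -> exists d, 0 < d /\
     forall u, 0 <= u -> Rabs (u - t) < d -> Cdist (gamma u) (gamma t) < e)
  (gamma_inj : forall t u, 0 <= t -> 0 <= u -> gamma t = gamma u -> t = u)
  (gamma_hair : forall t, 0 <= t -> hair lam s (gamma t))
  (gamma_infty : forall M, exists T, forall t, T <= t -> M < Cnorm (gamma t)).

(** Along the ray E^j tends to infinity, by induction on j through |E(p)| = lam e^(Re p). In a fixed
    strip only the real part can grow, and it is positive on the Julia set. *)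
Lemma Re_Eiter_ray_unbounded j M :
  exists T, forall t, T <= t -> 0 <= t -> M <= Re (Eiter lam j (gamma t)).
Proof.
assert (Hre : forall i t, 0 <= t -> Cnorm (Eiter lam i (gamma t))
  - (2 * Rabs (IZR (s i)) + 1) * PI <= Re (Eiter lam i (gamma t))).
{ intros i t Ht. destruct (gamma_hair t Ht) as [HJ Hs].
  apply Re_lower_bound_in_strip; [apply Hs |].
  pose proof (Julia_Re_ge_1 lam (gamma t) i lam_pos lam_small HJ). lra. }
revert M. induction j as [| j IH]; intros M.
- destruct (gamma_infty (M + (2 * Rabs (IZR (s 0%nat)) + 1) * PI)) as [T HT].
  exists T. intros t HTt Ht. specialize (HT t HTt). specialize (Hre 0%nat t Ht).
  change (Eiter lam 0 (gamma t)) with (gamma t) in *. lra.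
- set (B := (2 * Rabs (IZR (s (S j))) + 1) * PI).
  destruct (IH ((M + B) / lam)) as [T HT].
  exists T. intros t HTt Ht. specialize (HT t HTt Ht). specialize (Hre (S j) t Ht).
  change (Eiter lam (S j) (gamma t)) with (Eexp lam (Eiter lam j (gamma t))) in *.
  rewrite Cnorm_Eexp in Hre by exact lam_pos. fold B in Hre.
  pose proof (exp_ineq1_le (Re (Eiter lam j (gamma t)))).
  assert (lam * ((M + B) / lam) <= lam * exp (Re (Eiter lam j (gamma t))))
    by (apply Rmult_le_compat_l; lra).
  replace (lam * ((M + B) / lam)) with (M + B) in * by (field; lra). lra.
Qed.

(* Beyond a slower point, the ray meets [Re (E^n) = Re (E^n (gamma 0))] for every [n]; by expansion
   these points converge to [gamma 0], which properness and injectivity forbid. *)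
Lemma no_slower_point_on_ray t1 N : 0 < t1 ->
  (forall n, beta <= Re (Eiter lam n (gamma 0))) ->
  (forall n, (N <= n)%nat -> Re (Eiter lam n (gamma t1)) <= Re (Eiter lam n (gamma 0))) ->
  False.
Proof.
intros Ht1 Hbeta Hslow. set (w := gamma 0) in *.
(* The even extension is continuous on the whole line, as the real-variable theorems below
   demand. *)
pose (G := fun t => gamma (Rabs t)).
assert (HG : forall t, 0 <= t -> G t = gamma t)
  by (intros t Ht; unfold G; now rewrite Rabs_right by lra).
assert (Gcont : forall t e, 0 < e -> exists d, 0 < d /\
  forall u, Rabs (u - t) < d -> Cdist (G u) (G t) < e).
{ intros t e He. destruct (gamma_cont (Rabs t) (Rabs_pos t) e He) as (d & Hd & Hc).
  exists d. split; [exact Hd |]. intros u Hu. apply Hc; [apply Rabs_pos |].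
  eapply Rle_lt_trans; [apply Rabs_triang_inv2 | exact Hu]. }
set (dist1 := fun t => Rabs (Re (G t) - Re w) + Rabs (Im (G t) - Im w)).
(* On a compact part of the ray the minimum of [dist1] is positive by injectivity; further out the
   norm alone keeps the ray away from [w]. *)
assert (Hfar : exists mu, 0 < mu /\ forall t, t1 <= t -> mu <= dist1 t).
{ destruct (gamma_infty (Rabs (Re w) + Rabs (Im w) + 1)) as [T HT].
  set (T0 := Rmax t1 T).
  pose proof (Rmax_l t1 T). pose proof (Rmax_r t1 T). fold T0 in H, H0.
  destruct (continuity_ab_min dist1 t1 T0) as (mx & Hmx & Hmx01); [lra | |].
  { intros t _. apply continuity_pt_eps_delta. intros e He.
    destruct (Gcont t (e / 2)) as (d & Hd & Hc); [lra |].
    exists d. split; [exact Hd |]. intros u Hu. specialize (Hc u Hu).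
    pose proof (Re_le_Cdist (G u) (G t)). pose proof (Im_le_Cdist (G u) (G t)).
    pose proof (Rabs_triang_inv2 (Re (G u) - Re w) (Re (G t) - Re w)) as H3.
    pose proof (Rabs_triang_inv2 (Im (G u) - Im w) (Im (G t) - Im w)) as H4.
    replace (Re (G u) - Re w - (Re (G t) - Re w)) with (Re (G u) - Re (G t)) in H3 by ring.
    replace (Im (G u) - Im w - (Im (G t) - Im w)) with (Im (G u) - Im (G t)) in H4 by ring.
    apply Rabs_le_between in H3. apply Rabs_le_between in H4.
    unfold dist1. apply Rabs_def1; lra. }
  exists (Rmin 1 (dist1 mx)). split.
  - apply Rmin_pos; [lra |].
    destruct (Rle_lt_or_eq_dec 0 (dist1 mx)) as [Hpos | Hzero]; [| exact Hpos | exfalso].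
    + unfold dist1. pose proof (Rabs_pos (Re (G mx) - Re w)).
      pose proof (Rabs_pos (Im (G mx) - Im w)). lra.
    + unfold dist1 in Hzero. pose proof (Rabs_pos (Re (G mx) - Re w)) as H1.
      pose proof (Rabs_pos (Im (G mx) - Im w)) as H2.
      assert (H3 : Re (G mx) = Re w)
        by (apply Rminus_diag_uniq; destruct (Req_dec (Re (G mx) - Re w) 0) as [E | E];
            [exact E | apply Rabs_pos_lt in E; lra]).
      assert (H4 : Im (G mx) = Im w)
        by (apply Rminus_diag_uniq; destruct (Req_dec (Im (G mx) - Im w) 0) as [E | E];
            [exact E | apply Rabs_pos_lt in E; lra]).
      rewrite HG in H3, H4 by lra.
      assert (mx = 0); [| lra].
      apply gamma_inj; [lra | lra |].
      apply injective_projections; assumption.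
  - intros t Ht. destruct (Rle_dec t T0) as [Hle | Hgt].
    + eapply Rle_trans; [apply Rmin_r | apply Hmx; lra].
    + eapply Rle_trans; [apply Rmin_l |].
      specialize (HT t ltac:(lra)). rewrite <- HG in HT by lra.
      pose proof (Cnorm_le_sum (G t)) as H1.
      pose proof (Rabs_triang_inv (Re (G t)) (Re w)).
      pose proof (Rabs_triang_inv (Im (G t)) (Im w)).
      unfold dist1. lra. }
destruct Hfar as (mu & Hmu & Hfar).
assert (Hib : 0 < / beta < 1)
  by (split; [apply Rinv_0_lt_compat; lra | rewrite <- Rinv_1; apply Rinv_lt_contravar; lra]).
pose proof PI_RGT_0 as HPI.
(* At the crossing, the n-th images have equal real parts and lie in one strip, so they are within 2
   pi. Pulled back, the distance is below mu/2, and [dist1] is at most twice the distance. *)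
destruct (pow_small (/ beta) (mu / (4 * PI))) as [n0 Hn0];
  [lra | apply Rdiv_lt_0_compat; lra |].
set (n := max N n0).
specialize (Hn0 n ltac:(unfold n; lia)).
set (X := Re (Eiter lam n w)).
destruct (Re_Eiter_ray_unbounded n X) as [T HT].
destruct (IVT_cor (fun t => Re (Eiter lam n (G t)) - X) t1 (Rmax t1 T)) as (t & Ht & HtX).
- intros u. apply continuity_pt_minus; [| apply continuity_pt_const; now intros ? ?].
  apply continuity_pt_eps_delta. intros e He.
  destruct (Eiter_continuous lam n (G u) e lam_pos He) as (d & Hd & Hc).
  destruct (Gcont u d Hd) as (d' & Hd' & Hc').
  exists d'. split; [exact Hd' |]. intros v Hv.
  eapply Rle_lt_trans; [apply Re_le_Cdist | auto].
- apply Rmax_l.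
- pose proof (Rmax_l t1 T). pose proof (Rmax_r t1 T).
  rewrite !HG by lra.
  specialize (HT (Rmax t1 T) ltac:(lra) ltac:(lra)).
  specialize (Hslow n ltac:(unfold n; lia)). fold X in Hslow. nra.
- specialize (Hfar t ltac:(lra)).
  assert (Hz : Cdist (G t) w <= (/ beta) ^ n * (2 * PI)).
  { destruct (gamma_hair t ltac:(lra)) as [_ Hst]. destruct (gamma_hair 0 ltac:(lra)) as [_ Hsw].
    rewrite HG in * by lra. fold w in Hsw.
    eapply Rle_trans.
    - apply (Eiter_expands lam beta) with (s := s) (n := n); try assumption.
      + intros j _. apply Hst.
      + intros j _. apply Hsw.
      + specialize (Hbeta n). fold X in Hbeta. lra.
      + apply Hbeta.
    - apply Rmult_le_compat_l; [apply pow_le; lra |].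
      eapply Rle_trans; [apply Cdist_le_sum |].
      specialize (Hst n). specialize (Hsw n). fold X. rewrite HtX, Rabs_R0, Rplus_0_l.
      apply Rabs_le. lra. }
  assert (Hmun : (/ beta) ^ n * (2 * PI) < mu / 2).
  { apply Rlt_le_trans with (mu / (4 * PI) * (2 * PI)); [apply Rmult_lt_compat_r; lra |].
    right. field. lra. }
  pose proof (Re_le_Cdist (G t) w). pose proof (Im_le_Cdist (G t) w). unfold dist1 in Hfar. lra.
Qed.

End HairRay.

Lemma Re_Eiter_le_Eriter lam n k w : 0 < lam ->
  Re (Eiter lam (n + k) w) <= Eriter lam k (Re (Eiter lam n w)).
Proof.
intros Hlam. induction k as [| k IH]; [rewrite Nat.add_0_r; simpl; lra |].
rewrite Nat.add_succ_r.
change (Re (Eexp lam (Eiter lam (n + k) w)) <= lam * exp (Eriter lam k (Re (Eiter lam n w)))).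
eapply Rle_trans; [apply Rle_abs |]. eapply Rle_trans; [apply Re_le_Cnorm |].
rewrite Cnorm_Eexp by exact Hlam. apply Rmult_le_compat_l; [lra | now apply exp_le].
Qed.

(** * The set [X] *)

Section Main.

Context (lam beta x0 eps : R) (F : R -> R)
  (lam_pos : 0 < lam) (lam_small : lam < exp (-1))
  (beta_gt1 : 1 < beta) (beta_fix : lam * exp beta = beta)
  (F_eq : forall x, F (beta * x) = lam * exp (F x))
  (F_0 : F 0 = beta) (F_diff : derivable_pt_lim F 0 1)
  (x0_gt : beta < x0) (eps_pos : 0 < eps).
Context (w : Cx) (w_in : Xset lam F beta x0 eps w).

Lemma Xset_Re_gt n : beta < Re (Eiter lam n w).
Proof. destruct (w_in n) as (_ & H & _). lra. Qed.

Lemma Xset_Julia : Julia lam w.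
Proof.
apply (escaping_Julia lam beta); try assumption.
- intros j. left. apply Xset_Re_gt.
- intros M. destruct (Eriter_unbounded lam beta lam_pos beta_gt1 beta_fix x0 M x0_gt) as [n0 Hn0].
  exists n0. intros n Hn. specialize (Hn0 n Hn). destruct (w_in n) as (H & _). lra.
Qed.

Lemma Rpower_beta_opp : 0 < Rpower beta (- eps) < 1.
Proof.
split; [apply exp_pos |].
rewrite <- (Rpower_O beta) by lra. apply Rpower_lt; lra.
Qed.

(** The preimage [u] is positive since F u > beta = F 0 and F is increasing. *)
Lemma Xset_Im_bound n : exists u, 0 < u /\ F u = Re (Eiter lam n w) /\
  Rabs (Im (Eiter lam n w)) < F (Rpower beta (- eps) * u).
Proof.
destruct (w_in n) as (_ & _ & u & Hu & Him). exists u. repeat split; [| exact Hu | exact Him].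
apply Rnot_le_lt. intros Hle.
assert (F u <= F 0); [| pose proof (Xset_Re_gt n); lra].
destruct Hle as [Hlt | ->]; [left; now apply (F_increasing lam beta) | lra].
Qed.

(** The imaginary part of the next iterate is smaller than its real part, so lam e^Re, the modulus
    of that iterate, is less than twice its real part; and e >= 2. *)
Lemma Xset_growth n : lam * exp (Re (Eiter lam n w) - 1) <= Re (Eiter lam (S n) w).
Proof.
destruct (Xset_Im_bound (S n)) as (u & Hu & HuX & Him).
pose proof (Xset_Re_gt (S n)) as HX.
pose proof Rpower_beta_opp as Hrho.
assert (HF : F (Rpower beta (- eps) * u) < F u) by (apply (F_increasing lam beta); trivial; nra).
pose proof (Cnorm_le_sum (Eiter lam (S n) w)) as HN.
rewrite (Rabs_right (Re (Eiter lam (S n) w))) in HN by lra.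
change (Eiter lam (S n) w) with (Eexp lam (Eiter lam n w)) in HN at 1.
rewrite Cnorm_Eexp in HN by exact lam_pos.
set (X := Re (Eiter lam n w)) in *.
pose proof (exp_ineq1_le 1). pose proof (exp_pos (X - 1)).
replace (exp X) with (exp (X - 1) * exp 1) in HN by (rewrite <- exp_plus; f_equal; ring).
assert (0 < lam * exp (X - 1)) by (apply Rmult_lt_0_compat; assumption). nra.
Qed.

(* The gap [F u - F (beta^(-eps) u)] between [Re] and the bound for [Im] tends to infinity, which
   leaves room for an orbit with the same itinerary that starts between the two. *)
Lemma Xset_slower_point s : has_itinerary lam w s ->
  exists N z, hair lam s z /\
    forall n, (N <= n)%nat -> Re (Eiter lam n z) < Re (Eiter lam n w).
Proof.
intros Hs.
pose proof Rpower_beta_opp as Hrho. set (rho := Rpower beta (- eps)) in *.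
pose proof PI_RGT_0 as HPI. pose proof PI2_1 as HPI2.
(* For u >= U the gap F u - F (rho u) is at least pi + 3: the pi is spent in [y], the 3 in
   [Hgap]. *)
set (U := (PI + 3) / (1 - rho)).
assert (HU : 0 < U) by (apply Rdiv_lt_0_compat; lra).
destruct (Eriter_unbounded lam beta lam_pos beta_gt1 beta_fix x0 (F U) x0_gt) as [N HN].
specialize (HN N (le_n N)).
destruct (Xset_Im_bound N) as (u & Hu & HuX & _).
assert (HUu : U <= u).
{ apply (F_increasing_inv lam beta lam_pos beta_gt1 F); trivial.
  rewrite HuX. destruct (w_in N) as (H & _). lra. }
(* The added pi covers the distance from an imaginary part to the centre of its strip. *)
set (y := F (rho * u) + PI).
assert (Hrhou : 0 <= rho * u <= u) by nra.
assert (Hy : beta + PI <= y).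
{ pose proof (F_ge_beta lam beta lam_pos beta_gt1 F F_eq F_0 F_diff (rho * u) (proj1 Hrhou)).
  unfold y. lra. }
assert (HyX : y + 3 <= Re (Eiter lam N w)).
{ pose proof (F_expands lam beta lam_pos beta_gt1 beta_fix F F_eq F_0 F_diff u (rho * u)
    (proj1 Hrhou) (proj2 Hrhou)) as H.
  assert (PI + 3 <= (1 - rho) * u); [| rewrite <- HuX; unfold y; lra].
  replace (PI + 3) with ((1 - rho) * U) by (unfold U; field; lra).
  apply Rmult_le_compat_l; lra. }
assert (Ht : forall k, y <= Eriter lam k y).
{ induction k as [| k IH]; [simpl; lra |].
  destruct (Eriter_expands lam beta lam_pos beta_gt1 beta_fix k beta y) as [_ H]; [lra | lra |].
  change (y <= lam * exp (Eriter lam k y)).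
  pose proof (exp_ineq1_le (Eriter lam k y - beta)) as H1.
  replace (exp (Eriter lam k y)) with (exp beta * exp (Eriter lam k y - beta))
    by (rewrite <- exp_plus; f_equal; ring).
  rewrite <- Rmult_assoc, beta_fix. nra. }
(* A margin of 3 exceeds the width 2 of the shadowing boxes. It persists because e^2 >= 3 survives
   the loss of 1 in [Xset_growth]. *)
assert (Hgap : forall k, Eriter lam k y + 3 <= Re (Eiter lam (N + k) w)).
{ induction k as [| k IH]; [rewrite Nat.add_0_r; exact HyX |].
  rewrite Nat.add_succ_r. eapply Rle_trans; [| apply Xset_growth].
  specialize (Ht (S k)). change (Eriter lam (S k) y) with (lam * exp (Eriter lam k y)) in *.
  assert (exp (Eriter lam k y + 2) <= exp (Re (Eiter lam (N + k) w) - 1)) by (apply exp_le; lra).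
  rewrite exp_plus in H. pose proof (exp_ineq1_le 2). pose proof (exp_pos (Eriter lam k y)).
  assert (lam * (exp (Eriter lam k y) * 3) <= lam * exp (Re (Eiter lam (N + k) w) - 1)).
  { apply Rmult_le_compat_l; [lra |]. eapply Rle_trans; [| exact H].
    apply Rmult_le_compat_l; lra. }
  lra. }
(* The modulus bound gives v <= beta^k u, so the imaginary part at time N + k is below E^k(F(rho
   u)). Expansion keeps E^k(y) at least pi above that. *)
assert (Hst : forall k, Rabs (2 * PI * IZR (s (N + k)%nat)) <= Eriter lam k y).
{ intros k.
  destruct (Xset_Im_bound (N + k)) as (v & Hv & HvX & Him). fold rho in Him.
  assert (Hvu : v <= beta ^ k * u).
  { apply (F_increasing_inv lam beta lam_pos beta_gt1 F); trivial.
    rewrite (F_iter lam beta F F_eq), HuX, HvX. now apply Re_Eiter_le_Eriter. }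
  assert (HF : F (rho * v) <= Eriter lam k (F (rho * u))).
  { rewrite <- (F_iter lam beta F F_eq).
    assert (Hle : rho * v <= beta ^ k * (rho * u))
      by (rewrite (Rmult_comm rho u), <- Rmult_assoc, (Rmult_comm _ rho);
          apply Rmult_le_compat_l; lra).
    destruct Hle as [Hlt | ->]; [left; now apply (F_increasing lam beta) | lra]. }
  destruct (Eriter_expands lam beta lam_pos beta_gt1 beta_fix k (F (rho * u)) y) as [_ H].
  { apply (F_ge_beta lam beta); trivial. lra. }
  { unfold y. lra. }
  assert (1 <= beta ^ k) by (apply pow_R1_Rle; lra).
  replace (y - F (rho * u)) with PI in H by (unfold y; ring).
  specialize (Hs (N + k)%nat).
  apply Rabs_def2 in Him. apply Rabs_le. nra. }
pose (t := fun n => Eriter lam (n - N) y).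
destruct (exists_shadow lam beta lam_pos beta_gt1 beta_fix s t N) as (z & Hzs & Hz).
- intros n Hn. unfold t. now rewrite Nat.sub_succ_l.
- intros n _. specialize (Ht (n - N)%nat). unfold t. lra.
- intros n _. specialize (Ht (n - N)%nat). unfold t. lra.
- intros n Hn. specialize (Hst (n - N)%nat). now replace (N + (n - N))%nat with n in Hst by lia.
- exists N, z. split; [split; [| exact Hzs] |].
  + apply (escaping_Julia lam beta); try assumption.
    (* Shadowing controls real parts only from time [N] on; the bound at time N + j yields the one
       at time j. *)
    * intros j. apply (beta_le_Re_orbit lam beta lam_pos beta_fix (N + j)); [lia |].
      specialize (Hz (N + j)%nat ltac:(lia)). specialize (Ht (N + j - N)%nat). unfold t in Hz. lra.
    * intros M.
      destruct (Eriter_unbounded lam beta lam_pos beta_gt1 beta_fix y M ltac:(lra)) as [n0 Hn0].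
      exists (N + n0)%nat. intros n Hn. specialize (Hn0 (n - N)%nat ltac:(lia)).
      specialize (Hz n ltac:(lia)). unfold t in Hz. lra.
  + intros n Hn. specialize (Hz n Hn). specialize (Hgap (n - N)%nat).
    replace (N + (n - N))%nat with n in Hgap by lia. unfold t in Hz. lra.
Qed.

Lemma Xset_not_endpoint : ~ Endpoints lam w.
Proof.
intros (s & gamma & H0 & Hcont & Hinj & Hhair & Hinf).
assert (Hray : forall t, 0 <= t -> hair lam s (gamma t))
  by (intros t Ht; apply Hhair; now exists t).
destruct (Hray 0 ltac:(lra)) as [_ Hs]. rewrite H0 in Hs.
destruct (Xset_slower_point s Hs) as (N & z & Hz & Hslow).
destruct (proj1 (Hhair z) Hz) as (t1 & Ht1 & Htz).
apply (no_slower_point_on_ray lam beta lam_pos lam_small beta_gt1 beta_fix s gamma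
  Hcont Hinj Hray Hinf t1 N).
(* Were t1 = 0, [z] would be [w] itself, which is not slower than itself. *)
- destruct Ht1 as [Ht1 | <-]; [exact Ht1 | exfalso].
  specialize (Hslow N (le_n N)). rewrite <- Htz, H0 in Hslow. lra.
- intros n. rewrite H0. left. apply Xset_Re_gt.
- intros n Hn. rewrite H0, Htz. left. now apply Hslow.
Qed.

End Main.

Theorem theorem1p5 (lam beta x0 eps : R) (S : R -> R) (a : nat -> R) :
  0 < lam -> lam < exp (-1) ->
  1 < beta -> lam * exp beta = beta ->
  (* S is (the restriction to R of) the entire solution of S(beta z) = E(S(z)),
     S(0) = beta, S'(0) = 1; it has real Taylor coefficients a *)
  (forall x, Pser a x (S x)) ->
  (forall x, S (beta * x) = lam * exp (S x)) ->
  S 0 = beta -> derivable_pt_lim S 0 1 ->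
  beta < x0 -> 0 < eps ->
  forall w : Cx, Xset lam S beta x0 eps w -> Julia lam w /\ ~ Endpoints lam w.
Proof.
intros Hlam Hsmall Hbeta Hfix _ Heq H0 Hdiff Hx0 Heps w Hw. split.
- now apply (Xset_Julia lam beta x0 eps S).
- now apply (Xset_not_endpoint lam beta x0 eps S).
Qed.
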